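(* Let $\nu$ be a pm valuation on $K(\chi)$, $1=d_1<d_2<\cdots<d_k<\cdots$ be the (finite or infinite) sequence of key degrees of $\nu$, and $\mathcal{F}$ be a family of key polynomials for $\nu$ which satisfies the following properties for every $k\ge1$. If $d_k$ is an independent key degree, then $\mathcal{F}$ contains exactly one key polynomial $\Phi_{d_k}$ of degree $d_k$, and $\nu(\Phi_{d_k})=\max(\nu(\chi^{d_k}-K_{d_k-1}[\chi]))$. For notational convenience, for every integer $m$ set $\Phi_{d_k,m}=\Phi_{d_k}$. If $d_k$ is an immediate key degree, then the key polynomials of degree $d_k$ of $\mathcal{F}$ form a sequence $(\Phi_{d_k,m})$ such that the sequence $(\nu(\Phi_{d_k,m}))$ is increasing and cofinal in $\nu(\chi^{d_k}-K_{d_k-1}[\chi])$. For every $k,m_1,\dots,m_k$, let $\nu_{(m_1,\dots,m_k)}=\nu_{\Phi_{d_1,m_1},\dots,\Phi_{d_k,m_k}}$. Then $\mathcal{F}$ is a complete family of key polynomials for $\nu$. Furthermore, for every $f\in K[\chi]$, there are infinitely many tuples $(m_1,\dots,m_k)$ such that $\nu_{(m_1,\dots,m_k)}(f)=\nu(f)$.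
   Context: $K$ is a field, $\chi\notin K$ is algebraic or transcendental over $K$; $[K[\chi]:K]=\infty$ if $\chi$ is transcendental. When $\chi$ is algebraic, elements of $K[\chi]$ are written uniquely as polynomials in $\chi$ of degree $<[K[\chi]:K]$. $K_m[\chi]$ is the $K$-module of polynomials of degree at most $m$. A $K$-module valuation is a map $\nu$ to $\Gamma\cup\{\infty\}$, $\Gamma$ a linearly ordered abelian group, such that $\nu(y)=\infty\Leftrightarrow y=0$, $\nu(y_1+y_2)\ge\min(\nu(y_1),\nu(y_2))$ and $\nu(xy)=\nu(x)+\nu(y)$ for $x\in K$. It is a pm (partially multiplicative) valuation if $\nu(fg)=\nu(f)+\nu(g)$ for all $f,g\in K[\chi]$ with $\deg(f)+\deg(g)<[K[\chi]:K]$; if $\chi$ is transcendental one requires moreover that $\nu$ is a field valuation on $K(\chi)$. It is assumed that $\nu K$ has finite rank. $\nu(\chi^d-K_{d-1}[\chi])$ is the set of values ($\infty$ excluded) of monic polynomials of degree $d$. For $\Phi$ monic of degree $d$, $1\le d<[K[\chi]:K]$, and $f,g\in K_{d-1}[\chi]$, $q_\Phi(f,g)$ and $r_\Phi(f,g)$ are the quotient and remainder of the euclidean division of $fg$ by $\Phi$. $\Phi$ is a key polynomial for $\nu$ if $\nu(fg)=\nu(r_\Phi(f,g))<\nu(q_\Phi(f,g)\Phi)$ for all nonzero $f,g\in K_{d-1}[\chi]$ with $\deg(f)+\deg(g)<[K[\chi]:K]$. $d$ is a key degree if there is a key polynomial of degree $d$; it is immediate if $\nu(\chi^d-K_{d-1}[\chi])$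 has no maximal element, independent otherwise. For $\Phi$ monic of degree $d$, a $K$-module valuation $\mu$ and $\gamma$ in an ordered group extending the value group, $\mu_{\Phi,\gamma}(f):=\min_{0\le i\le m}(\mu(f_i)+i\gamma)$ for $f=f_0+f_1\Phi+\cdots+f_m\Phi^m$ with $f_i\in K_{d-1}[\chi]$, $\deg(f_m)+dm<[K[\chi]:K]$. For irreducible monic polynomials $\Phi_1,\dots,\Phi_n$ with $\deg(\Phi_1)<\cdots<\deg(\Phi_n)$, $\nu_{\Phi_1}:=\nu_{\Phi_1,\nu(\Phi_1)}$ (the valuation just defined with $\mu=\nu$, $\gamma=\nu(\Phi_1)$) and inductively $\nu_{\Phi_1,\dots,\Phi_n}:=(\nu_{\Phi_1,\dots,\Phi_{n-1}})_{\Phi_n,\nu(\Phi_n)}$. A family $\mathcal{F}$ of key polynomials is a complete family of key polynomials for $\nu$ if $\nu$ is the supremum of the family of the $\nu_{\Phi_{d_1},\dots,\Phi_{d_k}}$, where $k\in\mathbb{N}\setminus\{0\}$ and, for $1\le i\le k$, $\Phi_{d_i}\in\mathcal{F}$ has degree $d_i$. This means that if $f$ is a polynomial of degree $d\ge1$, then $\nu(f)$ is equal to the maximum of the values $\nu_{\Phi_{d_1},\dots,\Phi_{d_k}}(f)$, where $d_k$ is the greatest key degree at most equal to $d$. *)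

(* Defs.v *)
From HB Require Import structures.
From mathcomp Require Import all_boot all_order all_algebra.
From mathcomp Require Import all_classical.

Set Implicit Arguments.
Unset Strict Implicit.
Unset Printing Implicit Defensive.

Import Order.TTheory GRing.Theory Num.Theory.
Local Open Scope classical_set_scope.
Local Open Scope ring_scope.

(* Linearly ordered abelian groups. MathComp's [porderZmodType] puts no
   compatibility condition on the order and the addition. *)
Record orderedAbGroup := OrderedAbGroup {
  oag_base : porderZmodType;
  oag_leT : total (<=%R : rel oag_base);
  oag_leD2l : forall x y z : oag_base, y <= z -> x + y <= x + z
}.

Definition oag_sort (G : orderedAbGroup) : Type := oag_base G.
Coercion oag_sort : orderedAbGroup >-> Sortclass.

HB.instance Definition _ (G : orderedAbGroup) :=
  Num.POrderedZmodule.on (oag_sort G).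
HB.instance Definition _ (G : orderedAbGroup) :=
  Order.POrder_isTotal.Build ring_display (oag_sort G) (@oag_leT G).

(* [ext G] is the disjoint union of [G] and a top element [\top] (infinity),
   absorbing for addition. As an Nmodule it satisfies [x *+ 0 = 0], also for
   [x = \top]. *)
Definition ext (G : Type) : Type := option G.
Definition fin (G : Type) (g : G) : ext G := Some g.

Section Ext.
Variable G : orderedAbGroup.
Implicit Types x y z : ext G.

Definition ext_add x y : ext G :=
  match x, y with Some a, Some b => Some (a + b) | _, _ => None end.

Definition ext_le x y : bool :=
  match x, y with
  | _, None => true
  | None, Some _ => false
  | Some a, Some b => a <= b
  end.

Lemma ext_addA : associative ext_add.
Proof. by move=> [a|] [b|] [c|] //=; rewrite addrA. Qed.

Lemma ext_addC : commutative ext_add.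
Proof. by move=> [a|] [b|] //=; rewrite addrC. Qed.

Lemma ext_add0 : left_id (Some 0) ext_add.
Proof. by move=> [a|] //=; rewrite add0r. Qed.

Lemma ext_le_refl : reflexive ext_le.
Proof. by case=> /=. Qed.

Lemma ext_le_anti : antisymmetric ext_le.
Proof. by move=> [a|] [b|] //= /le_anti ->. Qed.

Lemma ext_le_trans : transitive ext_le.
Proof. by move=> [a|] [b|] [c|] //=; apply: le_trans. Qed.

Lemma ext_le_total : total ext_le.
Proof. by move=> [a|] [b|] //=; apply: le_total. Qed.

HB.instance Definition _ := Choice.on (ext G).
HB.instance Definition _ :=
  GRing.isNmodule.Build (ext G) ext_addA ext_addC ext_add0.
HB.instance Definition _ := Order.Le_isPOrder.Build ring_display (ext G)
  ext_le_refl ext_le_anti ext_le_trans.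
HB.instance Definition _ :=
  Order.POrder_isTotal.Build ring_display (ext G) ext_le_total.

Lemma ext_lex1 x : x <= (None : ext G).
Proof. by case: x. Qed.

HB.instance Definition _ :=
  Order.hasTop.Build ring_display (ext G) ext_lex1.

Definition is_subgroup (A : set G) : Prop :=
  A 0 /\ forall a b, A a -> A b -> A (a - b).

Definition is_convex_in (A H : set G) : Prop :=
  forall a b, A a -> H b -> 0 <= a -> a <= b -> H a.

(* The convex subgroups form a chain, and the rank is the number of proper
   ones. *)
Definition finite_rank (A : set G) : Prop :=
  finite_set [set H : set G | [/\ is_subgroup H, H `<=` A & is_convex_in A H]].

End Ext.

Definition is_greatest (d : Order.disp_t) (T : porderType d) (A : set T) (a : T)
    : Prop := A a /\ ubound A a.

Definition degp (R : nzSemiRingType) (p : {poly R}) : nat := (size p).-1.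

Section Extension.
Variables (K L : fieldType) (iota : {rmorphism K -> L}) (chi : L).

Definition evchi (p : {poly K}) : L := (map_poly iota p).[chi].

Definition generates : Prop :=
  forall y : L, exists p q : {poly K},
    evchi q != 0 /\ y = evchi p / evchi q.

Definition has_annihilator (n : nat) : bool :=
  `[< exists p : {poly K}, [/\ p != 0, degp p = n & root (map_poly iota p) chi] >].

(* [K[chi] : K], the degree of the minimal polynomial; [None] is infinity. *)
Definition ext_degree : option nat :=
  match pselect (exists n, has_annihilator n) with
  | left h => Some (ex_minn h)
  | right _ => None
  end.

Definition lt_degree (n : nat) : bool :=
  if ext_degree is Some N then (n < N)%N else true.

(* n < [K[chi] : K] iff 1, chi, ..., chi ^+ n are linearly independent over K. *)
Lemma lt_degreeP (n : nat) :
  lt_degree n <->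
  forall p : {poly K}, (size p <= n.+1)%N -> evchi p = 0 -> p = 0.
Proof.
rewrite /lt_degree /ext_degree; case: pselect => [h|h].
  case: ex_minnP => N /asboolP[p [p0 dp rp]] minN; split=> [ltnN q sq q0|H].
    apply/eqP/negPn/negP => qn0.
    have /minN : has_annihilator (degp q).
      by apply/asboolP; exists q; split=> //; apply/rootP.
    move=> /(leq_trans ltnN); rewrite ltnNge; apply/negP; rewrite negbK.
    by rewrite /degp -subn1 leq_subLR add1n.
  rewrite ltnNge; apply/negP => leNn; move/eqP: p0; apply; apply: H; last first.
    exact/rootP.
  by move: dp leNn; rewrite /degp; case: (size p) => //= k ->.
split=> // _ q _ q0; apply/eqP/negPn/negP => qn0; apply: h.
by exists (degp q); apply/asboolP; exists q; split=> //; apply/rootP.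
Qed.

End Extension.

Section PhiAdic.
Variable K : fieldType.
Implicit Types p Phi : {poly K}.

(* f_i in the expansion p = f_0 + f_1 Phi + ... + f_m Phi ^+ m with
   deg f_i < deg Phi. *)
Definition digit Phi p (i : nat) : {poly K} := (p %/ Phi ^+ i) %% Phi.

Lemma digitE Phi p : (1 < size Phi)%N ->
  p = \sum_(i < size p) digit Phi p i * Phi ^+ i.
Proof.
move=> s1; have Phi0 : Phi != 0 by rewrite -size_poly_gt0 ltnW.
have E n : p = p %/ Phi ^+ n * Phi ^+ n + \sum_(i < n) digit Phi p i * Phi ^+ i.
  elim: n => [|n IH]; first by rewrite big_ord0 expr0 divp1 mulr1 addr0.
  rewrite big_ord_recr /= addrA addrAC {1}IH; congr (_ + _).
  by rewrite /digit exprSr -divp_divl -exprSr exprS mulrA -mulrDl -divp_eq.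
rewrite {1}[p](E (size p)) divp_small ?mul0r ?add0r //.
have := size_exp Phi (size p); have: (0 < size (Phi ^+ size p))%N.
  by rewrite size_poly_gt0 expf_neq0.
case: (size (Phi ^+ _)) => //= n _ ->; rewrite ltnS leq_pmull //.
by rewrite -ltnS prednK // ltnW.
Qed.

Variables (G : orderedAbGroup).

(* mu_{Phi, gamma}; the digits of index >= size p vanish, so they contribute
   mu 0 = \top and the range of the minimum is immaterial beyond m. *)
Definition augment (mu : {poly K} -> ext G) Phi (gamma : ext G) :
    {poly K} -> ext G :=
  fun p => \big[Order.min / \top%O]_(i < size p) (mu (digit Phi p i) + gamma *+ i).

End PhiAdic.

Section Valuation.
Variables (K L : fieldType) (iota : {rmorphism K -> L}) (chi : L).
Variables (G : orderedAbGroup) (nu : L -> ext G).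

Let ltN := lt_degree iota chi.

Definition pval (p : {poly K}) : ext G := nu (evchi iota chi p).

Definition module_valuation : Prop :=
  [/\ forall y, nu y = \top%O <-> y = 0,
      forall y z, Order.min (nu y) (nu z) <= nu (y + z)
    & forall (x : K) y, nu (iota x * y) = nu (iota x) + nu y].

Definition field_valuation : Prop :=
  [/\ forall y, nu y = \top%O <-> y = 0,
      forall y z, Order.min (nu y) (nu z) <= nu (y + z)
    & forall y z, nu (y * z) = nu y + nu z].

Definition pm_valuation : Prop :=
  [/\ module_valuation,
      forall f g : {poly K}, ltN (degp f + degp g)%N ->
        pval (f * g) = pval f + pval g
    & ~ algebraicOver iota chi -> field_valuation].

(* nu(K), infinity excluded *)
Definition base_values : set G := [set g | exists x : K, nu (iota x) = fin g].

(* nu(chi^d - K_{d-1}[chi]), infinity excluded *)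
Definition monic_values (d : nat) : set G :=
  [set g | exists P : {poly K}, [/\ P \is monic, degp P = d & pval P = fin g]].

Definition key_poly (Phi : {poly K}) : Prop :=
  [/\ Phi \is monic, (0 < degp Phi)%N, ltN (degp Phi)
    & forall f g : {poly K}, f != 0 -> g != 0 ->
        (size f <= degp Phi)%N -> (size g <= degp Phi)%N ->
        ltN (degp f + degp g)%N ->
        pval (f * g) = pval ((f * g) %% Phi) /\
        pval ((f * g) %% Phi) < pval ((f * g) %/ Phi * Phi)].

Definition key_degree (d : nat) : Prop :=
  exists Phi, key_poly Phi /\ degp Phi = d.

Definition immediate_key_degree (d : nat) : Prop :=
  key_degree d /\ ~ exists g, is_greatest (monic_values d) g.

Definition independent_key_degree (d : nat) : Prop :=
  key_degree d /\ ~ immediate_key_degree d.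

(* nu_{Phi_1, ..., Phi_n} *)
Definition nu_chain (Phis : seq {poly K}) : {poly K} -> ext G :=
  foldl (fun mu Phi => augment mu Phi (pval Phi)) pval Phis.

(* The key degrees d_1 < ... < d_k such that d_k is the greatest key degree at
   most equal to n. *)
Definition key_degrees_upto (n : nat) : seq nat :=
  [seq d <- seq.iota 1 n | `[< key_degree d >]].

(* The sequences (Phi_{d_1}, ..., Phi_{d_k}) of elements of F with
   deg Phi_{d_i} = d_i, for d_1, ..., d_k as above. *)
Definition key_chains (F : set {poly K}) (n : nat) : set (seq {poly K}) :=
  [set Phis | (forall Phi, Phi \in Phis -> F Phi) /\
              [seq degp Phi | Phi <- Phis] = key_degrees_upto n].

(* Since 1 is a key degree, as n ranges over the positive integers,
   [key_degrees_upto n] ranges over all the (d_1, ..., d_k), k >= 1. *)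
Definition complete_family (F : set {poly K}) : Prop :=
  [/\ forall Phi, F Phi -> key_poly Phi,
      forall f, ltN (degp f) ->
        supremums [set v | exists n Phis, [/\ (0 < n)%N, key_chains F n Phis
                                             & v = nu_chain Phis f]] (pval f)
    & forall f, (0 < degp f)%N -> ltN (degp f) ->
        is_greatest [set nu_chain Phis f | Phis in key_chains F (degp f)]
                    (pval f)].

(* [Phi d m] is Phi_{d,m}. "Increasing" is taken in the weak sense, so that
   strictly increasing sequences are covered as well. *)
Definition adapted_family (F : set {poly K}) (Phi : nat -> nat -> {poly K})
    : Prop :=
  [/\ forall P, F P -> key_poly P,
      forall d, independent_key_degree d ->
        [/\ [set P | F P /\ degp P = d] = [set Phi d 0%N],
            exists g, pval (Phi d 0%N) = fin g /\
                      is_greatest (monic_values d) g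
          & forall m, Phi d m = Phi d 0%N]
    & forall d, immediate_key_degree d ->
        [/\ [set P | F P /\ degp P = d] = range (Phi d),
            forall m m', (m <= m')%N -> pval (Phi d m) <= pval (Phi d m')
          & forall g, monic_values d g -> exists m, fin g <= pval (Phi d m)]].

(* nu_(m_1, ..., m_k), with d_1, ..., d_k the key degrees at most n *)
Definition nu_tuple (Phi : nat -> nat -> {poly K}) (n : nat) (ms : seq nat)
    : {poly K} -> ext G :=
  nu_chain [seq Phi dm.1 dm.2 | dm <- zip (key_degrees_upto n) ms].

End Valuation.

(* Main.v *)
(* For a key polynomial [Phi] of degree d, the augmentation
   [w = nu_{Phi, nu Phi}] satisfies [w <= nu], agrees with [nu] in degrees < d,
   and is multiplicative on products of degree < [K[chi] : K]. If [Phi] runs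
   through a sequence of key polynomials of degree d whose values are cofinal in
   those of the monic polynomials of degree d, these augmentations increase, and
   a monic polynomial of least degree on which they never reach [nu] is again a
   key polynomial, of degree > d. Hence every polynomial whose degree is below
   the next key degree is eventually given its exact value. Applying this to a
   polynomial, then to its digits, and so on down the key degrees gives the
   tuples, in which every index can be taken arbitrarily large. Independent and
   immediate key degrees are treated alike. *)

Require Import Defs.
From HB Require Import structures.
From mathcomp Require Import all_boot all_order all_algebra.
From mathcomp Require Import all_classical.
From mathcomp Require Import zify.

Set Implicit Arguments.
Unset Strict Implicit.
Unset Printing Implicit Defensive.

Import Order.TTheory GRing.Theory Num.Theory.
Local Open Scope classical_set_scope.
Local Open Scope ring_scope.

(** * Ordered group arithmetic with infinity *)

Section ExtTheory.
Variable G : orderedAbGroup.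
Implicit Types x y z t : ext G.

Lemma ext_addtop x : (\top%O : ext G) + x = \top%O.
Proof. by []. Qed.

Lemma ext_leD x y z t : x <= y -> z <= t -> x + z <= y + t.
Proof.
case: x y z t => [x|] [y|] [z|] [t|] // xy zt.
have xy' : x <= y := xy; have zt' : z <= t := zt.
suff : x + z <= y + t by [].
apply: (le_trans (oag_leD2l _ zt')).
by rewrite addrC [y + t]addrC; apply: oag_leD2l.
Qed.

Lemma ext_ltD2r x y z : z != \top%O -> x < y -> x + z < y + z.
Proof.
move=> zfin xy; rewrite lt_neqAle (ext_leD (ltW xy) (lexx z)) andbT.
apply: contraTneq xy; rewrite -leNgt.
case: z x y zfin => [z|] [x|] [y|] // _ [E].
by have/addIr -> : x + z = y + z := E.
Qed.

Lemma ext_ltD2l x y z : z != \top%O -> x < y -> z + x < z + y.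
Proof. by rewrite ![z + _]addrC; apply: ext_ltD2r. Qed.

Lemma ext_minD z : {morph +%R^~ z : x y / Order.min x y}.
Proof.
move=> x y /=; case: (leP x y) => [xy|/ltW yx].
  by rewrite min_l // ext_leD.
by rewrite min_r // ext_leD.
Qed.

(** An ordered group has no 2-torsion: adding [x] to its comparison with 0 gives the reverse
    comparison. This forces [nu (-1) = 0]. *)
Lemma ext_double_eq0 x : x + x = 0 -> x = 0.
Proof.
case: x => [x|] // [E]; have {}E : x + x = 0 := E; congr Some.
have [x0|/ltW x0] := leP x 0; apply/le_anti/andP; split=> //.
  by have := oag_leD2l x x0; rewrite addr0 E.
by have := oag_leD2l x x0; rewrite addr0 E.
Qed.

(** Whichever of [x], [y] lies strictly below [z], the two ultrametric bounds pull the other one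
    onto it. It is meant for the values of [f * g], its remainder and the quotient term. *)
Lemma ext_ultrametric_eq x y z :
    Order.min y z <= x -> Order.min x z <= y -> Order.min x y < z ->
  x = y /\ y < z.
Proof.
rewrite !ge_min gt_min => h1 h2 h3.
suff xy : x = y by split=> //; move: h3; rewrite xy => /orP[].
apply/le_anti/andP; split.
  case/orP: h2 => // zy; case/orP: h3 => [xz|yz]; first exact: le_trans (ltW xz) zy.
  by have := le_lt_trans zy yz; rewrite ltxx.
case/orP: h1 => // zx; case/orP: h3 => [xz|yz]; last exact: le_trans (ltW yz) zx.
by have := le_lt_trans zx xz; rewrite ltxx.
Qed.

End ExtTheory.

(** * Degrees, euclidean division and common thresholds *)

Lemma degpM (R : idomainType) (p q : {poly R}) :
  p != 0 -> q != 0 -> degp (p * q) = (degp p + degp q)%N.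
Proof.
move=> p0 q0; rewrite /degp size_mul //.
move: p0 q0; rewrite -!size_poly_gt0.
by case: (size p) (size q) => [|m] [|n] //= _ _; rewrite addnS.
Qed.

Lemma degp_le_size (R : nzSemiRingType) (p q : {poly R}) :
  (size p <= size q)%N -> (degp p <= degp q)%N.
Proof. by move=> le_pq; rewrite /degp -!subn1 leq_sub2r. Qed.

Lemma degp_divp (F : fieldType) (p q : {poly F}) :
  p %/ q != 0 -> (degp (p %/ q)%R + degp q <= degp p)%N.
Proof.
have [->|q0] := eqVneq q 0; first by rewrite divp0 eqxx.
rewrite -size_poly_gt0 /degp size_divp // subn_gt0 => lt.
by rewrite -subn1 subnAC subnK ?subn1 // -ltnS (leq_trans lt) // leqSpred.
Qed.

Lemma size_sub_monic (R : nzRingType) (p q : {poly R}) :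
    p \is monic -> q \is monic -> size p = size q ->
  (size (p - q)%R < size p)%N.
Proof.
move=> pm qm spq; have p0 : (0 < size p)%N by rewrite size_poly_gt0 monic_neq0.
rewrite -(prednK p0) ltnS; apply/leq_sizeP => j; rewrite leq_eqVlt => /predU1P[<-|lt].
  rewrite coefB {2}spq; move/monicP: pm; move/monicP: qm.
  by rewrite /lead_coef => -> ->; rewrite subrr.
have sj : (size p <= j)%N by rewrite -(prednK p0).
by rewrite coefB !nth_default ?subrr // -spq.
Qed.

Lemma seq_threshold (T : eqType) (s : seq T) (A : nat -> T -> Prop) :
    (forall x, x \in s -> exists M, forall m, (M <= m)%N -> A m x) ->
  exists M, forall m, (M <= m)%N -> forall x, x \in s -> A m x.
Proof.
elim: s => [|x s IH] As; first by exists 0%N.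
have [|M HM] := IH; first by move=> y ys; apply: As; rewrite inE ys orbT.
have [M' HM'] := As x (mem_head _ _).
exists (maxn M M') => m; rewrite geq_max => /andP[leM leM'] y.
by rewrite inE => /predU1P[->|ys]; [apply: HM' | apply: HM].
Qed.

(** * Augmentation as a recursion along euclidean division *)

Section Augment.
Variables (K : fieldType) (G : orderedAbGroup) (mu : {poly K} -> ext G).
Variables (Phi : {poly K}) (gamma : ext G).
Hypothesis mu0 : mu 0 = \top%O.
Hypothesis Phi_gt1 : (1 < size Phi)%N.

Let Phi_neq0 : Phi != 0.
Proof. by rewrite -size_poly_gt0 ltnW. Qed.

(** Since [Phi ^+ i] has size above [i], digits past [size p] vanish and contribute infinity. A
    common range then serves both [p] and [p %/ Phi]. *)
Lemma augment_widen (p : {poly K}) (n : nat) : (size p <= n)%N ->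
  augment mu Phi gamma p =
  \big[Order.min / \top%O]_(i < n) (mu (digit Phi p i) + gamma *+ i).
Proof.
have lt_size_exp i : (i < size (Phi ^+ i)%R)%N.
  have pos : (0 < size (Phi ^+ i)%R)%N by rewrite size_poly_gt0 expf_neq0.
  by rewrite -(prednK pos) ltnS size_exp leq_pmull // -subn1 subn_gt0.
move=> le_pn; apply/le_anti/andP; split; last first.
  exact: (le_bigmin_ord xpredT (fun i => mu (digit Phi p i) + gamma *+ i)).
apply: le_bigmin => [|i _]; first exact: lex1.
have [lt_ip|le_pi] := ltnP i (size p); first exact: (bigmin_le _ (Ordinal lt_ip)).
rewrite /digit divp_small ?mod0p ?mu0 ?ext_addtop ?lex1 //.
exact: leq_ltn_trans (lt_size_exp i).
Qed.

(** Digit 0 is the remainder, and the later digits are those of the quotient shifted by one, each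
    shift costing one [gamma]. *)
Lemma augment_rec (p : {poly K}) :
  augment mu Phi gamma p =
  Order.min (mu (p %% Phi)) (augment mu Phi gamma (p %/ Phi) + gamma).
Proof.
rewrite (augment_widen (leqnSn (size p))) big_ord_recl; congr Order.min.
  by rewrite /digit expr0 divp1 mulr0n addr0.
rewrite (augment_widen (leq_divp p Phi)).
rewrite (big_morph _ (ext_minD gamma) (ext_addtop gamma)).
apply: eq_bigr => i _; rewrite /digit /= /bump /= add1n mulrSr addrA.
by rewrite divp_divl -exprS.
Qed.

Lemma augment0 : augment mu Phi gamma 0 = \top%O.
Proof. by rewrite /augment size_poly0 big_ord0. Qed.

Lemma augment_small (p : {poly K}) : (size p < size Phi)%N ->
  augment mu Phi gamma p = mu p.
Proof.
move=> sp; rewrite augment_rec divp_small // modp_small // augment0.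
by rewrite ext_addtop min_l ?lex1.
Qed.

Lemma augment_mulPhi (p : {poly K}) :
  augment mu Phi gamma (p * Phi) = augment mu Phi gamma p + gamma.
Proof. by rewrite augment_rec modp_mull mulpK // mu0 min_r ?lex1. Qed.

End Augment.

(** * Elementary properties of a pm valuation *)

Section KeyPolynomials.
Variables (K L : fieldType) (iota : {rmorphism K -> L}) (chi : L).
Variables (G : orderedAbGroup) (nu : L -> ext G).
Hypothesis nu_pm : pm_valuation iota chi nu.

Let ltN := lt_degree iota chi.
Let v := pval iota chi nu.

Lemma lt_degree_leq (m n : nat) : (m <= n)%N -> ltN n -> ltN m.
Proof.
by rewrite /ltN /lt_degree; case: ext_degree => // N; apply: leq_ltn_trans.
Qed.

Lemma pval0 : v 0 = \top%O.
Proof.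
by case: nu_pm => -[nu_top _ _] _ _; apply/nu_top; rewrite /evchi rmorph0 horner0.
Qed.

(** Below the extension degree, evaluation at [chi] kills no nonzero polynomial. *)
Lemma pval_fin (p : {poly K}) : ltN (degp p) -> p != 0 -> v p != \top%O.
Proof.
case: nu_pm => -[nu_top _ _] _ _ ltp p0; apply/eqP => /nu_top evp.
move/eqP: p0; apply; apply: (proj1 (lt_degreeP iota chi _) ltp) => //.
by rewrite /degp leqSpred.
Qed.

Lemma pvalD (p q : {poly K}) : Order.min (v p) (v q) <= v (p + q).
Proof.
case: nu_pm => -[_ nuD _] _ _.
by rewrite /v /pval {3}/evchi rmorphD hornerD; apply: nuD.
Qed.

Lemma pvalM (p q : {poly K}) : ltN (degp p + degp q)%N -> v (p * q) = v p + v q.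
Proof. by case: nu_pm => _ + _; apply. Qed.

Lemma nu1 : nu 1 = 0.
Proof.
case: nu_pm => -[nu_top _ nuM] _ _.
have := nuM 1 1; rewrite rmorph1 mulr1.
case E : (nu 1) => [a|]; last by move/nu_top/eqP: E; rewrite oner_eq0.
by move=> [] /(congr1 (fun b => b - a)); rewrite subrr addrK => <-.
Qed.

Lemma pval1 : v 1 = 0.
Proof. by rewrite /v /pval /evchi rmorph1 hornerC nu1. Qed.

Lemma pvalN (p : {poly K}) : v (- p) = v p.
Proof.
case: nu_pm => -[_ _ nuM] _ _.
have nuN1 : nu (iota (-1)) = 0.
  by apply: ext_double_eq0; rewrite -nuM -rmorphM mulrNN mulr1 rmorph1 nu1.
by rewrite /v /pval {1}/evchi rmorphN hornerN -mulN1r -(rmorphN1 iota) nuM nuN1 add0r.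
Qed.

Lemma pvalB (p q : {poly K}) : Order.min (v p) (v q) <= v (p - q).
Proof. by rewrite -(pvalN q) pvalD. Qed.

(** * Augmentation by one key polynomial: a multiplicative minorant *)

Section Augmentation.
Variable Phi : {poly K}.
Hypothesis Phi_key : key_poly iota chi nu Phi.

Let Phi_neq0 : Phi != 0.
Proof. by case: Phi_key => /monic_neq0. Qed.

Let Phi_gt1 : (1 < size Phi)%N.
Proof. by case: Phi_key => _; rewrite /degp -subn1 subn_gt0. Qed.

Let w := augment v Phi (v Phi).

Let w_rec (p : {poly K}) : w p = Order.min (v (p %% Phi)) (w (p %/ Phi) + v Phi).
Proof. exact: augment_rec pval0 Phi_gt1 p. Qed.

Let w_small (p : {poly K}) : (size p < size Phi)%N -> w p = v p.
Proof. exact: augment_small pval0 Phi_gt1 p. Qed.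

Let w0 : w 0 = \top%O := augment0 v Phi (v Phi).

Let w_mulPhi (p : {poly K}) : w (p * Phi) = w p + v Phi.
Proof. exact: augment_mulPhi pval0 Phi_gt1 p. Qed.

Let small_modp (p : {poly K}) : (size (p %% Phi)%R < size Phi)%N.
Proof. exact: ltn_modpN0. Qed.

Let size_le_degp (p : {poly K}) : (size p <= degp Phi)%N = (size p < size Phi)%N.
Proof. by rewrite /degp -[in RHS](prednK (ltnW Phi_gt1)) ltnS. Qed.

Let w_modp (p : {poly K}) : w (p %% Phi) = v (p %% Phi).
Proof. exact: w_small. Qed.

Let size_divp_lt (p : {poly K}) : p != 0 -> (size (p %/ Phi)%R < size p)%N.
Proof.
move=> p0; rewrite size_divp // ltn_subrL size_poly_gt0 p0 andbT.
by rewrite -subn1 subn_gt0.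
Qed.

Let w_le_modp (p : {poly K}) : w p <= v (p %% Phi).
Proof. by rewrite w_rec ge_min lexx. Qed.

Let w_le_divp (p : {poly K}) : w p <= w (p %/ Phi) + v Phi.
Proof. by rewrite w_rec ge_min lexx orbT. Qed.

Lemma pval_divp_mul (p : {poly K}) : ltN (degp p) ->
  v (p %/ Phi * Phi) = v (p %/ Phi) + v Phi.
Proof.
move=> ltp; have [->|q0] := eqVneq (p %/ Phi) 0.
  by rewrite mul0r pval0 ext_addtop.
by rewrite pvalM //; apply: lt_degree_leq ltp; apply: degp_divp.
Qed.

(** By induction on the size, [w] takes the minimum over the two terms of the division by [Phi], and
    the ultrametric inequality puts [v] of their sum above it. *)
Lemma augment_le_pval (p : {poly K}) : ltN (degp p) -> w p <= v p.
Proof.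
have [n le_pn] := ubnP (size p); elim: n => // n IH in p le_pn *; move=> ltp.
have [->|p0] := eqVneq p 0; first by rewrite pval0 lex1.
rewrite w_rec [in leRHS](divp_eq p Phi); apply: le_trans (pvalD _ _).
rewrite minC le_min !ge_min lexx orbT andbT; apply/orP; left.
rewrite pval_divp_mul // ext_leD // IH //.
  by rewrite (leq_trans (size_divp_lt p0)).
by apply: lt_degree_leq ltp; apply: degp_le_size (leq_divp _ _).
Qed.

Lemma augment_fin (p : {poly K}) : ltN (degp p) -> p != 0 -> w p != \top%O.
Proof.
move=> ltp p0; apply: contraNneq (pval_fin ltp p0) => wp.
by rewrite -le1x -wp augment_le_pval.
Qed.

Lemma augmentD (p q : {poly K}) : Order.min (w p) (w q) <= w (p + q).
Proof.
have [n] := ubnP (maxn (size p) (size q)); elim: n => // n IH in p q *.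
rewrite ltnS geq_max => /andP[le_pn le_qn].
have [->|p0] := eqVneq p 0; first by rewrite add0r ge_min lexx orbT.
have [->|q0] := eqVneq q 0; first by rewrite addr0 ge_min lexx.
rewrite (w_rec (p + q)) divpD modpD le_min; apply/andP; split.
  apply: le_trans (pvalD _ _).
  by rewrite le_min !ge_min !w_le_modp orbT.
apply: le_trans (ext_leD (IH _ _ _) (lexx _)).
  by rewrite ext_minD le_min !ge_min !w_le_divp orbT.
by rewrite gtn_max !(leq_trans (size_divp_lt _)).
Qed.

(** If both factors are smaller than [Phi], this is the key condition. Otherwise the larger factor
    is divided by [Phi] and induction treats its quotient and remainder. *)
Lemma augmentM_ge (p q : {poly K}) : ltN (degp p + degp q)%N ->
  w p + w q <= w (p * q).
Proof.
have [n] := ubnP (size p + size q)%N; elim: n => // n IH in p q *.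
rewrite ltnS => le_n ltpq.
have [->|p0] := eqVneq p 0; first by rewrite mul0r w0 lex1.
have [->|q0] := eqVneq q 0; first by rewrite mulr0 w0 lex1.
wlog le_qp : p q le_n ltpq p0 q0 / (size q <= size p)%N.
  move=> H; case/orP: (leq_total (size q) (size p)) => le; first exact: H.
  by rewrite addrC mulrC; apply: H => //; rewrite addnC.
have [lt_pPhi|le_Phip] := ltnP (size p) (size Phi).
  have lt_qPhi := leq_ltn_trans le_qp lt_pPhi.
  have [_ _ _ key] := Phi_key.
  have [|| vr lt_vr] := key _ _ p0 q0 _ _ ltpq; rewrite ?size_le_degp //.
  have lt_mul : ltN (degp (p * q)) by rewrite degpM.
  rewrite (w_small lt_pPhi) (w_small lt_qPhi) -pvalM // w_rec le_min {1}/v vr lexx /=.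
  (* The quotient of a product of two polynomials smaller than [Phi] is again smaller than [Phi], so
     [w] and [v] agree on it. *)
  rewrite w_small; first by rewrite -pval_divp_mul // ltW // /v vr.
  rewrite size_divp // size_mul //.
  have lt_sub (a b c : nat) : (a < c -> b < c -> (a + b).-1 - c.-1 < c)%N.
    by clear; lia.
  exact: lt_sub.
have q1_neq0 : p %/ Phi != 0 by rewrite divp_eq0 !negb_or p0 Phi_neq0 -leqNgt.
have lt1 : (size (p %/ Phi)%R + size q < n)%N.
  by rewrite (leq_trans _ le_n) // -addSn leq_add2r size_divp_lt.
have lt0 : (size (p %% Phi)%R + size q < n)%N.
  by rewrite (leq_trans _ le_n) // -addSn leq_add2r (leq_trans (small_modp p)).
rewrite [in leRHS](divp_eq p Phi) mulrDl mulrAC; apply: le_trans (augmentD _ _).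
rewrite le_min w_mulPhi; apply/andP; split.
  apply: le_trans (ext_leD (IH _ _ lt1 _) (lexx _)).
    by rewrite addrAC ext_leD // w_le_divp.
  apply: lt_degree_leq ltpq; rewrite leq_add2r degp_le_size //.
  exact: leq_divp.
apply: le_trans (IH _ _ lt0 _).
  by rewrite ext_leD // w_modp w_le_modp.
by apply: lt_degree_leq ltpq; rewrite leq_add2r degp_le_size // leq_modp.
Qed.

(** Either the quotient term alone gives the value of one factor, and induction passes to that
    quotient, or both values come from the remainders, and the key condition applies to these. *)
Lemma augmentM_le (p q : {poly K}) : ltN (degp p + degp q)%N ->
  w (p * q) <= w p + w q.
Proof.
have [n] := ubnP (size p + size q)%N; elim: n => // n IH in p q *.
rewrite ltnS => le_n ltpq.
have [->|p0] := eqVneq p 0; first by rewrite w0 ext_addtop lex1.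
have [->|q0] := eqVneq q 0; first by rewrite w0 addrC ext_addtop lex1.
have ltp : ltN (degp p) by apply: lt_degree_leq ltpq; rewrite leq_addr.
have ltq : ltN (degp q) by apply: lt_degree_leq ltpq; rewrite leq_addl.
have wp := augment_fin ltp p0; have wq := augment_fin ltq q0.
have high_p (f g : {poly K}) : (size f + size g <= n)%N ->
    ltN (degp f + degp g)%N -> f != 0 -> w g != \top%O ->
    w (f %/ Phi) + v Phi < v (f %% Phi) -> w (f * g) <= w f + w g.
  move=> le_fg ltfg f0 wg lt_f.
  have -> : w f = w (f %/ Phi) + v Phi by rewrite w_rec min_r // ltW.
  (* Otherwise subtracting [(f %% Phi) * g], whose value is also too large, gives
     [(f %/ Phi) * g * Phi] a value excluded by induction. *)
  rewrite leNgt; apply/negP => lt_fg.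
  have : w (f %/ Phi) + v Phi + w g < w ((f %/ Phi) * g * Phi).
    have -> : (f %/ Phi) * g * Phi = f * g + (- (f %% Phi)) * g.
      by rewrite {2}(divp_eq f Phi) mulrAC mulNr mulrDl addrK.
    apply: lt_le_trans (augmentD _ _); rewrite lt_min lt_fg /=.
    apply: lt_le_trans (augmentM_ge _).
      by apply: ext_ltD2r => //; rewrite (w_small (p := - _)) ?size_polyN // pvalN.
    apply: lt_degree_leq ltfg; rewrite leq_add2r degp_le_size // size_polyN.
    exact: leq_modp.
  rewrite w_mulPhi addrAC; apply/negP; rewrite -leNgt ext_leD // IH //.
    by rewrite (leq_trans _ le_fg) // -addSn leq_add2r size_divp_lt.
  apply: lt_degree_leq ltfg; rewrite leq_add2r degp_le_size //.
  exact: leq_divp.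
have [le_p|lt_p] := leP (v (p %% Phi)) (w (p %/ Phi) + v Phi); last exact: high_p.
have [le_q|lt_q] := leP (v (q %% Phi)) (w (q %/ Phi) + v Phi); last first.
  by rewrite mulrC addrC; apply: high_p => //; rewrite addnC.
have Ep : w p = v (p %% Phi) by rewrite w_rec min_l.
have Eq : w q = v (q %% Phi) by rewrite w_rec min_l.
have rp0 : p %% Phi != 0 by apply: contraNneq wp => r0; rewrite Ep r0 pval0.
have rq0 : q %% Phi != 0 by apply: contraNneq wq => r0; rewrite Eq r0 pval0.
have le_deg (r : {poly K}) : (size (r %% Phi)%R <= degp Phi)%N.
  by rewrite size_le_degp.
have ltr : ltN (degp (p %% Phi)%R + degp (q %% Phi)%R)%N.
  by apply: lt_degree_leq ltpq; rewrite leq_add // degp_le_size // leq_modp.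
have [_ _ _ key] := Phi_key.
have [vr _] := key _ _ rp0 rq0 (le_deg p) (le_deg q) ltr.
(* The remainder of [p * q] is that of the product of the two remainders, whose value the key
   condition supplies. *)
rewrite w_rec ge_min Ep Eq -pvalM // /v vr; apply/orP; left.
by rewrite modp_mul [_ %% _ * q]mulrC modp_mul mulrC.
Qed.

Lemma augmentM (p q : {poly K}) : ltN (degp p + degp q)%N ->
  w (p * q) = w p + w q.
Proof. by move=> ltpq; apply/le_anti; rewrite augmentM_le ?augmentM_ge. Qed.

End Augmentation.

(** * Comparing augmentations in the same degree *)

(** In [P = Q + (P - Q)] the difference has smaller degree, so its augmented value is [v (P - Q)],
    and both terms have value at least [v P]. *)
Lemma augment_monic_ge (P Q : {poly K}) : key_poly iota chi nu Q ->
    P \is monic -> size P = size Q -> v P <= v Q ->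
  v P <= augment v Q (v Q) P.
Proof.
move=> keyQ Pmonic sPQ le_PQ; have [Qmonic Q_gt0 _ _] := keyQ.
have Q_gt1 : (1 < size Q)%N by move: Q_gt0; rewrite /degp -subn1 subn_gt0.
have lt_size : (size (P - Q)%R < size Q)%N by rewrite -sPQ size_sub_monic.
have PE : P = 1 * Q + (P - Q) by rewrite mul1r addrC subrK.
rewrite [X in _ <= augment _ _ _ X]PE; apply: le_trans (augmentD keyQ _ _).
rewrite (augment_mulPhi _ pval0 Q_gt1).
rewrite !(augment_small _ pval0 Q_gt1) ?size_poly1 // pval1 add0r le_min le_PQ.
by apply: le_trans (pvalB _ _); rewrite le_min lexx.
Qed.

(** Dividing [p] by [P], the [Q]-augmentation agrees with [v] on the remainder, dominates on the
    quotient by induction, and is at least [v P] on [P]. *)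
Lemma augment_mono (P Q : {poly K}) : key_poly iota chi nu P ->
    key_poly iota chi nu Q -> size P = size Q -> v P <= v Q ->
  forall p, ltN (degp p) -> augment v P (v P) p <= augment v Q (v Q) p.
Proof.
move=> keyP keyQ sPQ vPQ p.
have [Pmonic P_gt0 P_ltN _] := keyP; have [Qmonic _ _ _] := keyQ.
have P0 := monic_neq0 Pmonic; have Q0 := monic_neq0 Qmonic.
have P_gt1 : (1 < size P)%N by move: P_gt0; rewrite /degp -subn1 subn_gt0.
have Q_gt1 : (1 < size Q)%N by rewrite -sPQ.
have [n le_pn] := ubnP (size p); elim: n => // n IH in p le_pn *; move=> ltp.
have [->|p0] := eqVneq p 0; first by rewrite (augment0 v Q) lex1.
have small_mod : (size (p %% P)%R < size Q)%N by rewrite -sPQ ltn_modpN0.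
rewrite [in leRHS](divp_eq p P); apply: le_trans (augmentD keyQ _ _).
rewrite (augment_rec _ pval0 P_gt1) minC le_min !ge_min.
rewrite (augment_small _ pval0 Q_gt1 small_mod) lexx orbT andbT; apply/orP; left.
have [->|q0] := eqVneq (p %/ P) 0.
  by rewrite mul0r (augment0 v Q) lex1.
have le_q : (size (p %/ P)%R < n)%N.
  move: le_pn; rewrite ltnS; apply: leq_trans.
  by rewrite size_divp // ltn_subrL size_poly_gt0 p0 andbT -subn1 subn_gt0.
apply: le_trans (augmentM_ge keyQ _); last first.
  by apply: lt_degree_leq ltp; apply: degp_divp.
apply: ext_leD.
  by apply: IH => //; apply: lt_degree_leq ltp; apply: degp_le_size (leq_divp _ _).
exact: augment_monic_ge.
Qed.

(** * Key polynomials of one degree with cofinal values *)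

Section CofinalSequence.
Variables (d : nat) (Phi : nat -> {poly K}).
Hypothesis Phi_key : forall m, key_poly iota chi nu (Phi m).
Hypothesis Phi_deg : forall m, degp (Phi m) = d.
Hypothesis Phi_nondecr : forall m m', (m <= m')%N -> v (Phi m) <= v (Phi m').
Hypothesis Phi_cofinal : forall P : {poly K}, P \is monic -> degp P = d ->
  exists m, v P <= v (Phi m).

Let w m := augment v (Phi m) (v (Phi m)).

Let Phi_neq0 m : Phi m != 0.
Proof. by case: (Phi_key m) => /monic_neq0. Qed.

Let size_Phi m : size (Phi m) = d.+1.
Proof.
by rewrite -(Phi_deg m) /degp prednK // size_poly_gt0.
Qed.

Let d_gt0 : (0 < d)%N.
Proof. by rewrite -(Phi_deg 0); case: (Phi_key 0). Qed.

Let Phi_gt1 m : (1 < size (Phi m))%N.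
Proof. by rewrite size_Phi ltnS. Qed.

(** The [w m] increase with [m] and stay below [v], so reaching [v p] once suffices. *)
Let eventually_of_le (p : {poly K}) : ltN (degp p) ->
  (exists m, v p <= w m p) -> exists M, forall m, (M <= m)%N -> w m p = v p.
Proof.
move=> ltp [M le_vw]; exists M => m leMm; apply/le_anti.
rewrite augment_le_pval //= (le_trans le_vw) //.
by apply: augment_mono => //; rewrite ?size_Phi ?Phi_nondecr.
Qed.

(* If [p] is a monic polynomial of least degree whose value is never attained,
   then [p] is itself a key polynomial: for [f * g = q * p + r], the values of
   [f * g], [q] and [r] are attained at a common stage [m], where
   [v (q * p) > w m (q * p) >= min (v (f * g)) (v r)]. *)
Lemma eventually_augment_eq (p : {poly K}) : ltN (degp p) ->
    (forall e, (d < e <= degp p)%N -> ~ key_degree iota chi nu e) ->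
  exists M, forall m, (M <= m)%N -> w m p = v p.
Proof.
have [n le_pn] := ubnP (size p); elim: n => // n IH in p le_pn *.
move=> ltp nokey.
have [->|p0] := eqVneq p 0.
  by exists 0%N => m _; rewrite /w augment0 pval0.
(* Scaling by a nonzero constant shifts [v] and [w m] by the same amount. *)
wlog pmonic : p le_pn ltp nokey p0 / p \is monic.
  move=> H; pose c := lead_coef p; have c0 : c != 0 by rewrite lead_coef_eq0.
  have size_cp : size (c^-1 *: p) = size p by rewrite size_scale // invr_eq0.
  have deg_cp : degp (c^-1 *: p) = degp p by rewrite /degp size_cp.
  have [||||| M HM] := H (c^-1 *: p); rewrite ?size_cp ?deg_cp //.
  - by rewrite scaler_eq0 invr_eq0 negb_or c0.
  - by rewrite monicE lead_coefZ mulVf.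
  apply: eventually_of_le => //; exists M.
  have -> : p = c%:P * (c^-1 *: p) by rewrite mul_polyC scalerA divff ?scale1r.
  have lt_cp : ltN (degp c%:P + degp (c^-1 *: p))%N.
    by rewrite deg_cp /degp size_polyC c0.
  apply: le_trans (augmentM_ge (Phi_key M) lt_cp).
  rewrite (augment_small _ pval0 (Phi_gt1 M)) ?size_polyC ?c0 ?Phi_gt1 //.
  by rewrite pvalM //; apply: ext_leD; rewrite // -/(w M _) HM.
have size_p : size p = (degp p).+1 by rewrite /degp prednK // size_poly_gt0.
apply: eventually_of_le => //.
case: (ltngtP (degp p) d) => [lt_pd|lt_dp|deg_p].
- exists 0%N; rewrite /w (augment_small _ pval0 (Phi_gt1 0%N)) //.
  by rewrite size_Phi size_p ltnS.
- apply: contrapT => nle; case: (nokey (degp p)); first by rewrite lt_dp leqnn.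
  exists p; split=> //; split=> // [|f g f0 g0 sf sg ltfg].
    exact: ltn_trans lt_dp.
  have lt_wv m : w m p < v p by rewrite ltNge; apply/negP => le; apply: nle; exists m.
  have p_gt1 : (1 < size p)%N by rewrite size_p ltnS (ltn_trans d_gt0).
  have attained (h : {poly K}) : (size h < size p)%N -> ltN (degp h) ->
      exists M, forall m, (M <= m)%N -> w m h = v h.
    move=> lt_h lth; apply: IH => //; first exact: leq_trans lt_h _.
    move=> e /andP[lt_de le_e]; apply: nokey; rewrite lt_de (leq_trans le_e) //.
    by apply: degp_le_size; apply: ltnW.
  have fg0 : f * g != 0 by rewrite mulf_neq0.
  have lt_mul : ltN (degp (f * g)) by rewrite degpM.
  set r := (f * g) %% p; set q := (f * g) %/ p.
  have lt_r : (size r < size p)%N by rewrite ltn_modpN0.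
  have lt_q : (size q < size p)%N.
    rewrite size_divp // size_mul // size_p.
    have lt_sub (a b c : nat) : (a <= c -> b <= c -> (a + b).-1 - c < c.+1)%N.
      by clear; lia.
    exact: lt_sub.
  have ltr : ltN (degp r).
    by apply: lt_degree_leq lt_mul; apply: degp_le_size (leq_modp _ _).
  have ltq : ltN (degp q).
    by apply: lt_degree_leq lt_mul; apply: degp_le_size (leq_divp _ _).
  have ltf : ltN (degp f) by apply: lt_degree_leq ltfg; rewrite leq_addr.
  have ltg : ltN (degp g) by apply: lt_degree_leq ltfg; rewrite leq_addl.
  have fgE : f * g = q * p + r := divp_eq (f * g) p.
  rewrite -/v; have [q0|q0] := eqVneq q 0.
    have -> : f * g = r by rewrite fgE q0 mul0r add0r.
    split=> //; rewrite q0 mul0r pval0 ltx1 pval_fin //.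
    by apply: contraNneq fg0 => r0; rewrite fgE q0 r0 mul0r add0r.
  have qpE : q * p = f * g - r by rewrite fgE addrK.
  (* The first two bounds express [f * g = q * p + r]; only the strict inequality uses the stages
     [m]. *)
  apply: ext_ultrametric_eq.
  + by rewrite fgE minC pvalD.
  + have -> : r = f * g - q * p by rewrite fgE addrC addKr.
    exact: pvalB.
  have ltqp : ltN (degp q + degp p)%N.
    by apply: lt_degree_leq lt_mul; apply: degp_divp.
  have [|Mf Hf] := attained f _ ltf; first by rewrite size_p ltnS.
  have [|Mg Hg] := attained g _ ltg; first by rewrite size_p ltnS.
  have [Mq Hq] := attained q lt_q ltq.
  have [||Mr Hr] := attained (- r); rewrite ?size_polyN // /degp ?size_polyN //.
  pose m := maxn (maxn Mf Mg) (maxn Mq Mr).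
  have [leMf leMg leMq leMr] : [/\ Mf <= m, Mg <= m, Mq <= m & Mr <= m]%N.
    by rewrite /m !leq_max !leqnn !orbT.
  apply: (@le_lt_trans _ _ (w m (q * p))).
    have wfg : w m (f * g) = v (f * g).
      by rewrite [LHS](augmentM (Phi_key m) ltfg) pvalM // -(Hf m leMf) -(Hg m leMg).
    have : Order.min (w m (f * g)) (w m (- r)) <= w m (f * g - r).
      exact: augmentD (Phi_key m) _ _.
    by rewrite wfg (Hr m leMr) pvalN qpE.
  have -> : w m (q * p) = v q + w m p.
    by rewrite [LHS](augmentM (Phi_key m) ltqp) -(Hq m leMq).
  by rewrite pvalM //; apply: ext_ltD2l (lt_wv m); apply: pval_fin.
(* In degree exactly [d], cofinality provides a stage whose key polynomial has value at least
   [v p]. *)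
have [m le_m] := Phi_cofinal pmonic deg_p; exists m.
by apply: augment_monic_ge; rewrite // size_p size_Phi deg_p.
Qed.

End CofinalSequence.

(** * Chains of augmentations and the key degree 1 *)

Lemma nu_chain_rcons (Phis : seq {poly K}) (Phi : {poly K}) :
  nu_chain iota chi nu (rcons Phis Phi) =
  augment (nu_chain iota chi nu Phis) Phi (v Phi).
Proof. by rewrite /nu_chain foldl_rcons. Qed.

Lemma degp_digit (Phi p : {poly K}) (i : nat) : (degp (digit Phi p i) <= degp p)%N.
Proof. by apply: degp_le_size; rewrite (leq_trans (leq_modp _ _)) // leq_divp. Qed.

(** Augmenting [v] by the last key polynomial stays below [v], and replacing [v] on the digits by
    the shorter chain only lowers the minimum. *)
Lemma nu_chain_le (Phis : seq {poly K}) :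
    (forall P, P \in Phis -> key_poly iota chi nu P) ->
  forall p, ltN (degp p) -> nu_chain iota chi nu Phis p <= v p.
Proof.
elim/last_ind: Phis => [|Phis Phi IH] keyPhis p ltp; first exact: lexx.
rewrite nu_chain_rcons; apply: le_trans (augment_le_pval (keyPhis Phi _) ltp);
  last first.
  by rewrite mem_rcons mem_head.
apply: le_bigmin2 => i _; apply: ext_leD => //; apply: IH => [P PPhis|].
  by apply: keyPhis; rewrite mem_rcons inE PPhis orbT.
exact: lt_degree_leq (degp_digit _ _ _) ltp.
Qed.

(** A nonzero polynomial of degree at most 1 vanishing at [chi] would place [chi] in [K]. *)
Lemma lt_degree1 : (forall x : K, iota x <> chi) -> ltN 1%N.
Proof.
move=> chi_notin; apply/lt_degreeP => p sp; rewrite /evchi.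
have pE : p = (p`_1)%:P * 'X + (p`_0)%:P.
  apply/polyP => -[|[|i]]; rewrite coefD coefMX !coefC /= ?addr0 ?add0r //.
  by rewrite nth_default // (leq_trans sp).
have -> : (map_poly iota p).[chi] = iota p`_1 * chi + iota p`_0.
  by rewrite {1}pE rmorphD rmorphM /= map_polyX !map_polyC !hornerE.
have [p1|p1] := eqVneq p`_1 0.
  rewrite p1 rmorph0 mul0r add0r => /eqP.
  by rewrite fmorph_eq0 => /eqP p0; rewrite pE p1 p0 mul0r addr0.
move=> /eqP; rewrite addr_eq0 => /eqP chiE; case: (chi_notin (- p`_0 / p`_1)).
by rewrite rmorphM rmorphN /= fmorphV -chiE mulrAC divff ?mul1r // fmorph_eq0.
Qed.

(** For ['X] the factors are constants: their product is its own remainder, and the zero quotient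
    has infinite value. *)
Lemma key_degree1 : (forall x : K, iota x <> chi) -> key_degree iota chi nu 1.
Proof.
move=> chi_notin; exists 'X.
have degX : degp ('X : {poly K}) = 1%N by rewrite /degp size_polyX.
split=> //; split; rewrite ?degX ?monicX //; first exact: lt_degree1.
move=> f g f0 g0 sf sg ltfg.
have fg0 : f * g != 0 by rewrite mulf_neq0.
have small : (size (f * g)%R < size ('X : {poly K}))%N.
  rewrite size_polyX size_mul //.
  have lt_pred (a b : nat) : (a <= 1 -> b <= 1 -> (a + b).-1 < 2)%N by clear; lia.
  exact: lt_pred.
rewrite modp_small // divp_small // mul0r -/v pval0 ltx1; split=> //.
by rewrite pval_fin ?degpM.
Qed.

Lemma key_degrees_uptoS (n : nat) :
  key_degrees_upto iota chi nu n.+1 =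
  key_degrees_upto iota chi nu n ++
  (if `[< key_degree iota chi nu n.+1 >] then [:: n.+1] else [::]).
Proof. by rewrite /key_degrees_upto -[in LHS](addn1 n) iotaD filter_cat /= add1n. Qed.

(** * Exact tuples from an adapted family *)

Section AdaptedFamily.
Variables (F : set {poly K}) (Phi : nat -> nat -> {poly K}).
Hypothesis F_adapted : adapted_family iota chi nu F Phi.

(** Both kinds of key degree fit the cofinal setting: an independent one gives a constant sequence
    at the maximal value. *)
Lemma adapted_key_degree (d : nat) : key_degree iota chi nu d ->
  [/\ forall m, F (Phi d m), forall m, degp (Phi d m) = d,
      forall m m', (m <= m')%N -> v (Phi d m) <= v (Phi d m')
    & forall P : {poly K}, P \is monic -> degp P = d ->
        exists m, v P <= v (Phi d m)].
Proof.
move=> keyd; have ltd : ltN d by case: keyd => P [[_ _ ltP _] <-].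
have monic_value (P : {poly K}) : P \is monic -> degp P = d ->
    exists2 g, monic_values iota chi nu d g & v P = fin g.
  move=> Pmonic dP; have := pval_fin (p := P); rewrite dP => /(_ ltd).
  rewrite monic_neq0 // => /(_ isT); case E : (v P) => [g|] // _.
  by exists g => //; exists P.
have [_ indep immed] := F_adapted.
have [imm|nimm] := pselect (immediate_key_degree iota chi nu d).
  have [FE nondecr cof] := immed d imm.
  have FPhi m : F (Phi d m) /\ degp (Phi d m) = d.
    have : range (Phi d) (Phi d m) by exists m.
    by rewrite -FE.
  split=> [m|m|//|P Pmonic dP]; [exact: (FPhi m).1 | exact: (FPhi m).2 |].
  by have [g gP ->] := monic_value P Pmonic dP; apply: cof.
have [FE [g [gE [_ gmax]]] cst] := indep d (conj keyd nimm).
have FPhi0 : F (Phi d 0%N) /\ degp (Phi d 0%N) = d.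
  have : [set Phi d 0%N] (Phi d 0%N) by [].
  by rewrite -FE.
split=> [m|m|m m' _|P Pmonic dP]; rewrite ?cst ?[Phi d m']cst //.
- exact: FPhi0.1.
- exact: FPhi0.2.
exists 0%N; have [h hP ->] := monic_value P Pmonic dP.
by rewrite [leRHS]gE; apply: gmax.
Qed.

(* The indices are chosen from the last one down: once the outermost [m] is
   fixed, the digits are finitely many polynomials of degree below the last key
   degree, so the induction must treat a finite family at once. *)
Lemma nu_tuple_attained (B n : nat) (s : seq {poly K}) :
    (forall p, p \in s -> ltN (degp p) /\
       forall e, (n < e <= degp p)%N -> ~ key_degree iota chi nu e) ->
  exists ms : seq nat,
    [/\ size ms = size (key_degrees_upto iota chi nu n),
        forall m, m \in ms -> (B <= m)%N
      & forall p, p \in s -> nu_tuple iota chi nu Phi n ms p = v p].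
Proof.
(* For [n = 0] the chain is empty and [nu_chain] is [v] itself. *)
elim: n s => [|n IH] s Hs; first by exists [::].
rewrite /nu_tuple key_degrees_uptoS; case: asboolP => [keyn|nkeyn]; last first.
  rewrite cats0; apply: IH => p /Hs[ltp nokey]; split=> // e /andP[].
  rewrite leq_eqVlt => /predU1P[<- //|lt_ne le_e].
  by apply: nokey; rewrite lt_ne.
have [FPhi dPhi nondecr cof] := adapted_key_degree keyn.
have keyPhi m : key_poly iota chi nu (Phi n.+1 m) by case: F_adapted => + _ _; apply.
have [|M HM] := @seq_threshold _ s (fun m p =>
    augment v (Phi n.+1 m) (v (Phi n.+1 m)) p = v p).
  move=> p /Hs[ltp nokey].
  exact: (eventually_augment_eq keyPhi dPhi nondecr cof).
pose m := maxn B M; pose P := Phi n.+1 m.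
have size_P : size P = n.+2.
  by have := dPhi m; rewrite -/P /degp; case: (size P) => // k /= ->.
(* These have degree at most [n], so the condition on key degrees above [n] holds vacuously for
   them. *)
pose digits := [seq digit P p i | p <- s, i <- seq.iota 0 (size p)].
have [|ms [size_ms leB Hms]] := IH digits.
  move=> _ /allpairsPdep[p [i [ps _ ->]]]; have [ltp _] := Hs p ps.
  split=> [|e]; first exact: lt_degree_leq (degp_digit _ _ _) ltp.
  have le_n : (degp (digit P p i) <= n)%N.
    have P0 : P != 0 by rewrite -size_poly_gt0 size_P.
    have := ltn_modpN0 (p %/ P ^+ i) P0; rewrite -/(digit P p i) size_P ltnS /degp.
    by case: (size _).
  move=> /andP[lt_ne le_e].
  by have := leq_trans lt_ne (leq_trans le_e le_n); rewrite ltnn.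
exists (rcons ms m); split=> [|m'|p ps].
- by rewrite cats1 !size_rcons size_ms.
- by rewrite mem_rcons inE => /predU1P[->|/leB //]; rewrite leq_maxl.
(* Once the inner chain is exact on the digits, the outer augmentation is that of [v], which is
   exact at [p] since [m] is at least [M]. *)
rewrite cats1 zip_rcons // map_rcons nu_chain_rcons /= -[RHS](HM m) ?leq_maxr //.
apply: eq_bigr => i _; congr (_ + _); apply: Hms.
by apply/allpairsPdep; exists p, (val i); rewrite mem_iota add0n ltn_ord.
Qed.

End AdaptedFamily.

End KeyPolynomials.

(** * Completeness and infinitude of the exact tuples *)

Theorem theorem4p12 (K L : fieldType) (iota : {rmorphism K -> L}) (chi : L)
    (G : orderedAbGroup) (nu : L -> ext G)
    (F : set {poly K}) (Phi : nat -> nat -> {poly K})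
    (chi_notin_K : forall x : K, iota x <> chi)
    (L_eq_Kchi : generates iota chi)
    (nu_pm : pm_valuation iota chi nu)
    (rank_nuK : finite_rank (base_values iota nu))
    (F_adapted : adapted_family iota chi nu F Phi) :
  complete_family iota chi nu F /\
  forall f : {poly K}, lt_degree iota chi (degp f) ->
    let n := maxn 1 (degp f) in
    infinite_set
      [set ms : (size (key_degrees_upto iota chi nu n)).-tuple nat |
        nu_tuple iota chi nu Phi n ms f = pval iota chi nu f].
Proof.
have keyF P : F P -> key_poly iota chi nu P by case: F_adapted => + _ _; apply.
have chain_le n Phis f :
    lt_degree iota chi (degp f) -> key_chains iota chi nu F n Phis ->
    nu_chain iota chi nu Phis f <= pval iota chi nu f.
  by move=> ltf [FPhis _]; apply: nu_chain_le => // P /FPhis /keyF.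
have attained B n f : (degp f <= n)%N -> lt_degree iota chi (degp f) ->
    exists ms : seq nat,
    [/\ size ms = size (key_degrees_upto iota chi nu n),
        forall m, m \in ms -> (B <= m)%N
      & nu_tuple iota chi nu Phi n ms f = pval iota chi nu f].
  move=> le_fn ltf; have [|ms [size_ms leB Hms]] :=
    nu_tuple_attained nu_pm F_adapted B (n := n) (s := [:: f]).
    move=> p; rewrite inE => /eqP->; split=> // e /andP[lt_ne le_e].
    by have := leq_trans lt_ne (leq_trans le_e le_fn); rewrite ltnn.
  by exists ms; split=> //; apply: Hms; rewrite mem_head.
have attained_chain n f : (degp f <= n)%N -> lt_degree iota chi (degp f) ->
    exists2 Phis, key_chains iota chi nu F n Phis &
      nu_chain iota chi nu Phis f = pval iota chi nu f.
  move=> le_fn ltf; have [ms [size_ms _ Hms]] := attained 0%N n f le_fn ltf.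
  pose ds := key_degrees_upto iota chi nu n.
  exists [seq Phi dm.1 dm.2 | dm <- zip ds ms] => //.
  have Fdm dm : dm \in zip ds ms ->
      F (Phi dm.1 dm.2) /\ degp (Phi dm.1 dm.2) = dm.1.
    move=> dm_in; have : dm.1 \in ds.
      by rewrite -[ds](@unzip1_zip _ _ ds ms) ?size_ms // map_f.
    rewrite mem_filter => /andP[/asboolP keyd _].
    by have [FPhi dPhi _ _] := adapted_key_degree nu_pm F_adapted keyd.
  split=> [_ /mapP[dm /Fdm[FPhi _] ->] //|].
  rewrite -map_comp -/ds -[RHS](@unzip1_zip _ _ ds ms) ?size_ms //.
  by apply/eq_in_map => dm /Fdm[_].
split.
  split=> // f => [ltf|f_gt0 ltf].
    split=> [_ [n [Phis [_ chain ->]]]|u ub]; first exact: chain_le ltf chain.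
    (* The maximum with 1 covers constants, since the supremum ranges over positive [n]. *)
    have [Phis chain <-] := attained_chain (maxn 1 (degp f)) f (leq_maxr _ _) ltf.
    by apply: ub; exists (maxn 1 (degp f)), Phis; split=> //; rewrite leq_max.
  have [Phis chain E] := attained_chain _ f (leqnn _) ltf.
  by split=> [|_ [Qs chainQ <-]]; [exists Phis | apply: chain_le chainQ].
move=> f ltf n.
(* Tuples must have a first component: there is only one empty tuple. *)
have ds_gt0 : (0 < size (key_degrees_upto iota chi nu n))%N.
  rewrite lt0n size_eq0; apply/eqP => ds_nil.
  suff : 1%N \in key_degrees_upto iota chi nu n by rewrite ds_nil.
  rewrite mem_filter mem_iota /= add1n ltnS leq_max andbT.
  by apply/asboolP; apply: key_degree1.
set A := [set ms : _.-tuple nat | _] => /= Afin.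
(* Finiteness would bound the first components, yet an exact tuple exists with all indices at least
   [B]. *)
have [B HB] : exists B, forall ms, A ms -> (nth 0%N ms 0%N < B)%N.
  have [s sA] : exists s : seq (_.-tuple nat), A = [set` s] by apply/finite_seqP.
  exists (\max_(ms <- s) nth 0%N ms 0%N).+1 => ms; rewrite sA /= => ms_s.
  exact: (leq_bigmax_seq (P := xpredT) (F := fun ms : _.-tuple nat => nth 0%N ms 0%N)).
have [ms [size_ms leB Hms]] := attained B n f (leq_maxr _ _) ltf.
have Ams : A (Tuple (introT eqP size_ms)) by [].
by have := HB _ Ams; rewrite ltnNge leB // mem_nth ?size_ms.
Qed.
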